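(* Let $\phi\colon\mathbb{R}\to\mathbb{R}$ be a continuous restricted maximal general dual-feasible function (gDFF). Then for any $\epsilon>0$ there exists an extreme gDFF $\phi_{\mathrm{ext}}$ such that $\|\phi-\phi_{\mathrm{ext}}\|_\infty<\epsilon$.
   Context: A function $\phi\colon\mathbb{R}\to\mathbb{R}$ is a (valid) general dual-feasible function (gDFF) if for every finite family $(x_i)_{i\in I}$ of real numbers (repetitions allowed), $\sum_{i\in I}x_i\le 1$ implies $\sum_{i\in I}\phi(x_i)\le 1$. A gDFF $\phi$ is implied via scaling by a gDFF $\phi_1$ if $\beta\phi_1\ge\phi$ pointwise for some $0\le\beta\le 1$; $\phi$ is restricted maximal if it is not implied via scaling by any gDFF $\phi_1\neq\phi$. A gDFF is extreme if it cannot be written as a convex combination of two other different gDFFs; equivalently, whenever $\phi=\frac12(\phi_1+\phi_2)$ with gDFFs $\phi_1,\phi_2$, then $\phi_1=\phi_2=\phi$. Here $\|f\|_\infty=\sup_{x\in\mathbb{R}}|f(x)|$. *)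

(* Defs.v *)
From HB Require Import structures.
From mathcomp Require Import all_boot all_order all_algebra.
From mathcomp Require Import all_classical all_reals all_analysis.
Import Order.TTheory GRing.Theory Num.Theory.
Import numFieldNormedType.Exports.

Set Implicit Arguments.
Unset Strict Implicit.
Unset Printing Implicit Defensive.

Local Open Scope classical_set_scope.
Local Open Scope ring_scope.

Definition gDFF (R : realType) (phi : R -> R) : Prop :=
  forall (I : finType) (x : I -> R),
    \sum_(i : I) x i <= 1 -> \sum_(i : I) phi (x i) <= 1.

Definition implied_via_scaling (R : realType) (phi phi1 : R -> R) : Prop :=
  exists beta : R, 0 <= beta <= 1 /\ forall x, phi x <= beta * phi1 x.

Definition restricted_maximal (R : realType) (phi : R -> R) : Prop :=
  gDFF phi /\
  ~ exists phi1 : R -> R,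
      [/\ gDFF phi1, phi1 <> phi & implied_via_scaling phi phi1].

(* The two functions phi1 and phi2 below are automatically distinct from each
   other: if phi1 = phi2, the convex combination is phi1, which is not phi. *)
Definition extreme_gDFF (R : realType) (phi : R -> R) : Prop :=
  gDFF phi /\
  ~ exists (phi1 phi2 : R -> R) (t : R),
      [/\ gDFF phi1 /\ gDFF phi2, phi1 <> phi, phi2 <> phi, 0 <= t <= 1 &
          forall x, phi x = t * phi1 x + (1 - t) * phi2 x].

(* Extended-real valued, so that the norm of an unbounded function is +oo
   (the real-valued [sup] of an unbounded set is 0). *)
Definition sup_norm (R : realType) (f : R -> R) : \bar R :=
  ereal_sup [set `|f x|%:E | x in [set: R]].

(* Main.v *)
Require Import Defs.
From mathcomp Require Import all_boot all_order all_algebra.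
From mathcomp Require Import all_classical all_reals all_analysis.
From mathcomp Require Import ring lra zify.
Import Order.TTheory GRing.Theory Num.Theory.
Import numFieldNormedType.Exports.

Local Open Scope classical_set_scope.
Local Open Scope ring_scope.

(** The approximant is a two-slope function: continuous, piecewise linear, with
the slopes 0 and M only.

Why two slopes suffice.  Write an extreme candidate f, symmetric in the sense
f x + f (1 - x) = 1, as a convex combination of gDFFs f1 and f2.  Where f
attains equality in an inequality valid for all gDFFs, so do f1 and f2; hence
both are symmetric;
a symmetric gDFF is superadditive, nondecreasing and vanishes at 0.  Hence f1
is constant wherever f is.  Near 0 on the left f is linear of slope M, hence
additive, so f1 is additive and monotone there, that is, linear of some slope
M1; superadditivity carries the slope M1 to every steep piece of f.  Thus f1
and f differ by the factor M1 / M, which the value 1/2 at the point 1/2 forces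
to be 1 ([two_slope_extreme]).

What restricted maximality gives.  Raising phi at a single point must break
the gDFF property, whence phi is superadditive and monotone; and if
phi r + phi (1 - r) < 1, then phi is dominated by a line T x with T < 1, hence
implied via scaling by the identity ([restricted_maximal_symmetric]).  A
superadditive monotone function vanishing at 0 lies below a line T x, and by
symmetry phi lies above T x - (T - 1); so for T = 1 it is the identity, which is
extreme.

The construction for T > 1.  Let p be a convex combination of phi and a
function T x - (T - 1) k x with k bounded, which therefore moves phi by little,
and for which p w + p z >= 1 + p (w + z - 1) holds with a fixed slack when
w, z <= 1/2 and w + z < 1 ([perturb_slack]).  Sample p on the grid
(1/2m) Z and join consecutive values by a flat piece followed by a piece of
slope M, the steepest slope of p on the grid.  The result F is superadditive
([fill_superadditive]), but not symmetric; so keep F on the left of 1/2 and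
reflect it to the right.  Superadditivity of the reflected function reduces to
F w + F z >= 1 + F (w + z - 1) for w, z <= 1/2 ([symmetrize_superadditive]).
Since k jumps at 0, the slack does not degenerate as w and z approach 1/2, so the
mesh can be chosen after it, fine enough for the slack to beat the discretisation
error.  The exception is w + z - 1 within one cell of 0, where rounding to the
grid crosses the jump; there the inequality follows from F being exactly of
slope M on that cell ([fill_reflected]).  Superadditivity
turns continuity of phi at 0 into a bound for its oscillation on all cells of the
grid at once. *)

(** * Superadditive functions and symmetric gDFFs *)

Definition superadditive {R : realType} (f : R -> R) : Prop :=
  forall x y, f x + f y <= f (x + y).

Definition unit_symmetric {R : realType} (f : R -> R) : Prop :=
  forall x, f x + f (1 - x) = 1.

Lemma gDFF_seqP {R : realType} (phi : R -> R) :
  gDFF phi <-> forall s : seq R,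
    \sum_(x <- s) x <= 1 -> \sum_(x <- s) phi x <= 1.
Proof.
split=> [phiD s|phiD I x].
  rewrite (big_tnth _ _ s) [in X in _ -> X](big_tnth _ _ s).
  exact: (phiD 'I_(size s) (tnth (in_tuple s))).
have := phiD [seq x i | i <- enum I].
by rewrite !big_map -!big_enum.
Qed.

Lemma sum_nseq {R : realType} (F : R -> R) k x :
  \sum_(y <- nseq k x) F y = F x *+ k.
Proof. by rewrite big_nseq iter_addr_0. Qed.

Section Superadditive.
Context {R : realType} {f : R -> R}.
Hypotheses (fD : superadditive f) (f0 : f 0 = 0).

Lemma superadditive_sum (I : Type) (s : seq I) (x : I -> R) :
  \sum_(i <- s) f (x i) <= f (\sum_(i <- s) x i).
Proof.
elim: s => [|i s IH]; first by rewrite !big_nil f0.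
by rewrite !big_cons (le_trans _ (fD _ _))// lerD2l.
Qed.

Lemma superadditive_muln k x : k%:R * f x <= f (k%:R * x).
Proof.
have := superadditive_sum _ (nseq k x) id.
by rewrite !sum_nseq !mulr_natl.
Qed.

Lemma superadditive_gDFF : (forall x, x <= 1 -> f x <= 1) -> gDFF f.
Proof. by move=> f1 I x x1; exact: le_trans (superadditive_sum _ _ _) (f1 _ x1). Qed.

Hypothesis f_mono : {homo f : x y / x <= y}.

(** The left growth rate dominates the right one: choosing naturals m, n with
m b <= n a and m / n close to a / b, monotonicity bounds
m f b + n f (- a) by f 0. *)
Lemma superadditive_slopes a b : 0 < a -> 0 < b -> b * f (- a) + a * f b <= 0.
Proof.
move=> a0 b0; rewrite leNgt; apply/negP => S0.
set S := _ + _ in S0.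
have fb0 : 0 <= f b by rewrite -f0 f_mono// ltW.
have nS n : n%:R * S <= b * f b.
  have y0 : 0 <= n%:R * a / b by rewrite !mulr_ge0// ?invr_ge0 ltW.
  have /andP[my ym] := truncn_itv y0.
  set m := Num.truncn _ in my ym.
  have mb : m%:R * b <= n%:R * a by rewrite -ler_pdivlMr.
  have nb : n%:R * a <= m.+1%:R * b by rewrite -ler_pdivrMr// ltW.
  have h1 := superadditive_muln m b.
  have h2 := superadditive_muln n (- a).
  have h3 := fD (m%:R * b) (n%:R * - a).
  have h4 : f (m%:R * b + n%:R * - a) <= 0 by rewrite -f0 f_mono//; lra.
  have h5 : m%:R * f b + n%:R * f (- a) <= 0 by lra.
  rewrite -natr1 in nb.
  rewrite /S; nra.
have bf0 : 0 <= b * f b / S by rewrite mulr_ge0 ?invr_ge0 ?(ltW S0)// mulr_ge0// ltW.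
have := truncnS_gt (b * f b / S).
by rewrite ltr_pdivrMr// ltNge nS.
Qed.

(** T is the supremum of the right difference quotients at 0; it is finite, and
also bounds f on the negative side, by [superadditive_slopes]. *)
Lemma superadditive_linear_bound : exists T, forall x, f x <= T * x.
Proof.
pose A := [set f b / b | b in [set b : R | 0 < b]].
have ubA x : x < 0 -> ubound A (f x / x).
  move=> x0 _ [b /= b0 <-].
  have := @superadditive_slopes (- x) b; rewrite oppr_gt0 opprK => /(_ x0 b0) h.
  by rewrite ler_pdivrMr// mulrAC ler_ndivlMr//; lra.
have A0 : A !=set0 by exists (f 1 / 1), 1 => //=.
exists (sup A) => x; have [x0|x0|->] := ltgtP x 0; last by rewrite f0 mulr0.
  by rewrite -ler_ndivlMr//; apply: ge_sup => //; exact: ubA.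
rewrite -ler_pdivrMr//; apply: ub_le_sup; last by exists x.
by exists (f (-1) / -1); apply: ubA; lra.
Qed.

Lemma superadditive_increment x h : f (x + h) - f x <= - f (- h).
Proof. by have := fD (x + h) (- h); rewrite addrK; lra. Qed.

End Superadditive.

Section Symmetric.
Context {R : realType} {f : R -> R}.
Hypotheses (fG : gDFF f) (fS : unit_symmetric f).

Lemma gDFF_le1 x : x <= 1 -> f x <= 1.
Proof.
move=> x1; have := (gDFF_seqP f).1 fG [:: x].
by rewrite !big_seq1; apply.
Qed.

Lemma gDFF_at0_le : f 0 <= 0.
Proof.
rewrite leNgt; apply/negP => f0.
have := truncnS_gt (f 0)^-1; set n := (Num.truncn _).+1.
have := (gDFF_seqP f).1 fG (nseq n 0).
rewrite !sum_nseq mul0rn => /(_ ler01).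
rewrite -mulr_natl -[(f 0)^-1]mul1r ltr_pdivrMr//; lra.
Qed.

Lemma gDFF_sym_at0 : f 0 = 0.
Proof.
apply/le_anti; rewrite gDFF_at0_le/=.
by have := fS 1; have := gDFF_le1 _ (lexx 1); rewrite subrr; lra.
Qed.

(** Apply the gDFF property to x, y and 1 - (x + y), whose value symmetry trades
for that of x + y. *)
Lemma gDFF_sym_superadditive : superadditive f.
Proof.
move=> x y; have := (gDFF_seqP f).1 fG [:: x; y; 1 - (x + y)].
rewrite !big_cons !big_nil => /(_ _).
by have := fS (x + y); move=> ? h; have := h ltac:(lra); lra.
Qed.

Lemma gDFF_sym_mono : {homo f : x y / x <= y}.
Proof.
move=> x y xy; have := gDFF_sym_superadditive x (y - x).
have -> : x + (y - x) = y by lra.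
have := fS (y - x); have := gDFF_le1 (1 - (y - x)); move=> h; have := h ltac:(lra); lra.
Qed.

End Symmetric.

(** * Restricted maximal gDFFs are symmetric *)

Section RestrictedMaximal.
Context {R : realType} {phi : R -> R}.
Hypothesis phiM : restricted_maximal phi.

(** Otherwise the function equal to v at r and to phi elsewhere would be a gDFF
above phi: a family is split into its k entries equal to r and the rest. *)
Lemma restricted_maximal_raise (r v : R) :
  (forall k (s : seq R), r *+ k + \sum_(x <- s) x <= 1 ->
    v *+ k + \sum_(x <- s) phi x <= 1) -> v <= phi r.
Proof.
move=> H; rewrite leNgt; apply/negP => rv; apply: phiM.2.
exists (fun x => if x == r then v else phi x); split; last first.
- exists 1; split; first by lra.
  by move=> x; rewrite mul1r; case: eqP => [->|//]; exact: ltW.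
- by move=> /(congr1 (fun g => g r)); rewrite eqxx; lra.
- apply/gDFF_seqP => s.
  have [k [s' [-> ->]]] : exists k (s' : seq R),
      \sum_(x <- s) x = r *+ k + \sum_(x <- s') x /\
      \sum_(x <- s) (if x == r then v else phi x) =
        v *+ k + \sum_(x <- s') phi x.
    elim: s => [|x s [k [s' [e1 e2]]]].
      by exists 0%N, [::]; rewrite !big_nil !mulr0n !addr0.
    rewrite !big_cons e1 e2; case: eqP => [->|_].
      by exists k.+1, s'; rewrite !mulrS !addrA.
    by exists k, (x :: s'); rewrite !big_cons; split; ring.
  exact: H.
Qed.

Let phiG : gDFF phi := phiM.1.

Lemma restricted_maximal_superadditive : superadditive phi.
Proof.
move=> x y; apply: restricted_maximal_raise => k s xs.
have := (gDFF_seqP phi).1 phiG (nseq k x ++ nseq k y ++ s).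
rewrite !big_cat/= !sum_nseq !addrA -!mulrnDl; exact.
Qed.

Lemma restricted_maximal_mono : {homo phi : x y / x <= y}.
Proof.
move=> x y xy; apply: restricted_maximal_raise => k s xs.
have := (gDFF_seqP phi).1 phiG (nseq k x ++ s).
rewrite !big_cat/= !sum_nseq; apply.
by rewrite (le_trans _ xs)// lerD2r lerMn2r xy orbT.
Qed.

Lemma restricted_maximal_at0 : phi 0 = 0.
Proof.
apply/le_anti; rewrite (gDFF_at0_le phiG)/=; apply: restricted_maximal_raise => k s.
by rewrite !mul0rn !add0r; exact: (gDFF_seqP phi).1.
Qed.

Let phiD := restricted_maximal_superadditive.
Let phi_mono := restricted_maximal_mono.
Let phi0 := restricted_maximal_at0.

(** Raising phi at r by eta breaks the gDFF property, and by superadditivity the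
entries of a violating family other than its k copies of r merge into the
single entry 1 - k r. *)
Lemma restricted_maximal_tight (r eta : R) : 0 < eta ->
  exists k : nat, (0 < k)%N /\ 1 < phi (1 - k%:R * r) + k%:R * (phi r + eta).
Proof.
move=> eta0; apply: contrapT => H.
suff : phi r + eta <= phi r by lra.
apply: restricted_maximal_raise => k s ks; rewrite leNgt; apply/negP => ks1; apply: H.
exists k.
have h' : \sum_(x <- s) phi x <= phi (\sum_(x <- s) x).
  exact: superadditive_sum.
have h : phi (\sum_(x <- s) x) <= phi (1 - k%:R * r).
  by apply: phi_mono; rewrite mulr_natl; lra.
move: ks1; rewrite -[_ *+ k]mulr_natl => ks1; split; last lra.
rewrite lt0n; apply/eqP => k0; rewrite k0 !mul0r subr0 in h ks1.
by have := gDFF_le1 phiG _ (lexx 1); lra.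
Qed.

(** Merging all copies of r but one into 1 - k r would yield a violation by the
pair r, 1 - r, were k eta smaller than the gap. *)
Lemma gap_tight_copies (r eta : R) (k : nat) : (0 < k)%N ->
  1 < phi (1 - k%:R * r) + k%:R * (phi r + eta) ->
  1 - (phi r + phi (1 - r)) < k%:R * eta.
Proof.
case: k => // k _; rewrite -natr1 => h.
have h1 := superadditive_muln phiD phi0 k r.
have := phiD (1 - (k%:R + 1) * r) (k%:R * r).
have -> : 1 - (k%:R + 1) * r + k%:R * r = 1 - r by ring.
lra.
Qed.

(** Under a gap, shrinking eta forces the number of copies up. *)
Lemma gap_tight_unbounded (r eta C : R) : phi r + phi (1 - r) < 1 -> 0 < eta -> 0 < C ->
  exists k : nat, C < k%:R /\ 1 < phi (1 - k%:R * r) + k%:R * (phi r + eta).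
Proof.
move=> gap eta0 C0; set g := 1 - (phi r + phi (1 - r)).
have g0 : 0 < g by rewrite /g; lra.
have e0 : 0 < Num.min eta (g / C) by rewrite lt_min eta0 divr_gt0.
have [k [k0 hk]] := restricted_maximal_tight r _ e0.
have kg := gap_tight_copies _ _ _ k0 hk; rewrite -/g in kg.
have k0' : 0 < k%:R :> R by rewrite ltr0n.
exists k; split.
  have : g < k%:R * (g / C) by rewrite (lt_le_trans kg)// ler_pM2l// ge_min lexx orbT.
  by rewrite mulrCA -ltr_pdivrMl// mulVf ?gt_eqF// ltr_pdivlMr// mul1r.
by rewrite (lt_le_trans hk)// lerD2l ler_pM2l// lerD2l ge_min lexx.
Qed.

(** With many copies, the violation gives phi (1 - k r) >= - k phi r up to
negligible terms, so the left growth rate of phi is at most phi r / r, and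
[superadditive_slopes] passes this bound to positive x. *)
Lemma gap_linear_bound (r : R) : 0 < r -> phi r + phi (1 - r) < 1 ->
  forall x, r * phi x <= phi r * x.
Proof.
move=> r0 gap x; have [x0|x0|->] := ltgtP x 0; last by rewrite phi0 !mulr0.
  have := @superadditive_slopes _ _ phiD phi0 phi_mono (- x) r.
  by rewrite opprK oppr_gt0 => /(_ x0 r0); lra.
rewrite leNgt; apply/negP => th0.
have px0 : 0 <= phi x by rewrite -phi0 phi_mono// ltW.
set th := r * phi x - phi r * x.
have t0 : 0 < th by rewrite /th; lra.
have eta0 : 0 < th / (2 * x) by rewrite divr_gt0// mulr_gt0.
have h1 : 0 < r^-1 by rewrite invr_gt0.
have h2 : 0 <= 2 * phi x / th by rewrite divr_ge0 ?mulr_ge0// ltW.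
have [|k [kC hk]] := gap_tight_unbounded r _ (r^-1 + 2 * phi x / th) gap eta0; first lra.
have kr : 1 < k%:R * r by rewrite -ltr_pdivrMr// mul1r; lra.
have kt : 2 * phi x < k%:R * th by rewrite -ltr_pdivrMr//; lra.
have := @superadditive_slopes _ _ phiD phi0 phi_mono (k%:R * r - 1) x.
rewrite opprB subr_gt0 => /(_ kr x0) h.
have : x * 1 < x * (phi (1 - k%:R * r) + k%:R * (phi r + th / (2 * x))).
  by rewrite ltr_pM2l.
have -> : x * (phi (1 - k%:R * r) + k%:R * (phi r + th / (2 * x))) =
   x * phi (1 - k%:R * r) + k%:R * (x * phi r) + k%:R * th / 2.
  by field; rewrite gt_eqF.
rewrite /th in kt *; nra.
Qed.

(** Under a gap g at r, [gap_linear_bound] puts phi below the line T x through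
(r, phi r).  A violation at 1 - r with increment g / 2 is incompatible with
T >= 1, so phi is implied via scaling by the identity. *)
Lemma restricted_maximal_symmetric_gt0 (r : R) : 0 < r -> phi r + phi (1 - r) = 1.
Proof.
move=> r0; apply/eqP; rewrite eq_le; apply/andP; split.
  have := phiD r (1 - r); have -> : r + (1 - r) = 1 by ring.
  by have := gDFF_le1 phiG _ (lexx 1); lra.
rewrite leNgt; apply/negP => gap.
have lin := gap_linear_bound r r0 gap.
pose T := phi r / r.
have phiT x : phi x <= T * x.
  by rewrite /T mulrAC ler_pdivlMr// mulrC lin.
have phir : phi r = T * r by rewrite /T divfK// gt_eqF.
set g := 1 - (phi r + phi (1 - r)).
have g0 : 0 < g / 2 by rewrite /g; lra.
have T0 : 0 <= T.
  by rewrite divr_ge0 ?(ltW r0)// -phi0 phi_mono// ltW.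
have [l [l0 hl]] := restricted_maximal_tight (1 - r) _ g0.
have l1 : 1 <= l%:R :> R by rewrite ler1n.
have T1 : T < 1.
  have := phiT (1 - l%:R * (1 - r)).
  have phir' : phi (1 - r) = 1 - g - T * r by rewrite -phir /g; ring.
  rewrite phir' in hl => h.
  have key : 0 < (l%:R - 1) * (1 - T).
    have : 0 < l%:R * (g / 2) by rewrite mulr_gt0// ltr0n.
    lra.
  rewrite ltNge; apply/negP => T1.
  by move: key; rewrite ltNge mulr_ge0_le0//; lra.
apply: phiM.2; exists id; split.
- by move=> I x.
- by move=> /(congr1 (fun f => f r + f (1 - r))) /=; lra.
- by exists T; split; [rewrite T0 ltW|].
Qed.

Lemma restricted_maximal_symmetric : unit_symmetric phi.
Proof.
move=> x; have [x0|x0] := ltP 0 x; first exact: restricted_maximal_symmetric_gt0.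
have := restricted_maximal_symmetric_gt0 (1 - x).
have -> : 1 - (1 - x) = x by ring.
rewrite [phi x + _]addrC => H; apply: H; lra.
Qed.

End RestrictedMaximal.

(** * Two-slope functions are extreme *)

(** The defect E x = c g x - g c x from linearity is bounded, and additivity with
E c = 0 makes 2 E x again a value of E on [0, c]: doubling x, modulo c.  So E
vanishes. *)
Lemma additive_ge0_linear {R : realType} (g : R -> R) (c : R) : 0 < c ->
  (forall a b, 0 <= a -> 0 <= b -> a + b <= c -> g (a + b) = g a + g b) ->
  (forall a, 0 <= a <= c -> 0 <= g a) ->
  forall h, 0 <= h <= c -> c * g h = g c * h.
Proof.
move=> c0 gD g_ge0 h h0c.
pose E x := c * g x - g c * x.
have Ebound x : 0 <= x <= c -> `|E x| <= c * g c.
  move=> xc; have gx := g_ge0 x xc; have gcx := g_ge0 (c - x) ltac:(lra).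
  have := gD x (c - x) ltac:(lra) ltac:(lra) ltac:(lra).
  have -> : x + (c - x) = c by ring.
  move=> gc; rewrite /E ler_norml; nra.
have Edouble x : 0 <= x <= c -> exists y, 0 <= y <= c /\ E y = 2 * E x.
  move=> xc; have [x2|x2] := leP (x + x) c.
    exists (x + x); split; first lra.
    by rewrite /E gD//; [ring|lra|lra].
  exists (x + x - c); split; first lra.
  have e1 := gD (x + x - c) (c - x) ltac:(lra) ltac:(lra) ltac:(lra).
  have e2 := gD x (c - x) ltac:(lra) ltac:(lra) ltac:(lra).
  have e3 : x + x - c + (c - x) = x by ring.
  have e4 : x + (c - x) = c by ring.
  rewrite e3 in e1; rewrite e4 in e2.
  have e5 : g (x + x - c) = 2 * g x - g c by lra.
  rewrite /E e5; ring.
have Epow n x : 0 <= x <= c -> 2 ^+ n * `|E x| <= c * g c.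
  elim: n x => [|n IH] x xc; first by rewrite expr0 mul1r Ebound.
  have [y [yc Ey]] := Edouble x xc.
  by have := IH y yc; rewrite Ey normrM (@ger0_norm _ 2)// mulrA -exprSr.
apply/eqP; rewrite -subr_eq0 -/(E h) -normr_le0 leNgt; apply/negP => Eh.
have := truncnS_gt (c * g c / `|E h|); set n := (Num.truncn _).+1.
rewrite ltr_pdivrMr// ltNge => /negP; apply.
rewrite (le_trans _ (Epow n h h0c))// ler_pM2r//.
by rewrite -natrX ler_nat ltnW// ltn_expl.
Qed.

Lemma convex_eq0 {R : realType} (t a b : R) : 0 < t < 1 -> 0 <= a -> 0 <= b ->
  t * a + (1 - t) * b = 0 -> a = 0 /\ b = 0.
Proof.
move=> t01 a0 b0; have t1 : 0 < 1 - t by lra.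
have /andP[t0 _] := t01.
move=> e; have ta : 0 <= t * a by rewrite mulr_ge0// ltW.
have tb : 0 <= (1 - t) * b by rewrite mulr_ge0// ltW.
have /eqP : t * a = 0 by lra.
have /eqP : (1 - t) * b = 0 by lra.
by rewrite !mulf_eq0 (gt_eqF t0) (gt_eqF t1)/= => /eqP -> /eqP ->.
Qed.

(** The cells of length c are described on the left of 1/2 only, since symmetry
determines the rest.  With M1 the slope of f1 on [- c, 0], the quantity
M f1 x - M1 f x does not change along a flat piece nor along a steep one;
descending from 1/2 cell by cell, it is constant on x <= 1/2.  Its values at
1/2 and at 0 are (M - M1) / 2 and 0. *)
Lemma two_slope_extreme {R : realType} (f : R -> R) (M c : R) :
  gDFF f -> unit_symmetric f -> 0 < M -> 0 < c ->
  (forall x : R, - c <= x <= 0 -> f x = M * x) ->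
  (forall (n : nat) (x : R), 1 / 2 - n.+1%:R * c <= x < 1 / 2 - n%:R * c ->
    exists z : R, [/\ x <= z, z <= 1 / 2 - n%:R * c, f z = f x &
      f (1 / 2 - n%:R * c) - f z = M * (1 / 2 - n%:R * c - z)]) ->
  extreme_gDFF f.
Proof.
move=> fG fS M0 c0 flin fcell; split=> // -[f1 [f2 [t [[G1 G2] n1 n2 t01 ft]]]].
have t0 : t != 0.
  by apply/eqP => t0; apply: n2; apply/funext => x; rewrite ft t0; ring.
have t1 : t != 1.
  by apply/eqP => t1; apply: n1; apply/funext => x; rewrite ft t1; ring.
have {t0 t1}t01' : 0 < t < 1 by rewrite !lt_neqAle t1 [0 == t]eq_sym t0.
have [S1 S2] : unit_symmetric f1 /\ unit_symmetric f2.
  have pair (g : R -> R) (x : R) : gDFF g -> g x + g (1 - x) <= 1.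
    move=> gG; have := (gDFF_seqP g).1 gG [:: x; 1 - x].
    rewrite !big_cons !big_nil !addr0; apply.
    by rewrite le_eqVlt; apply/orP; left; apply/eqP; ring.
  suff H x : 1 - (f1 x + f1 (1 - x)) = 0 /\ 1 - (f2 x + f2 (1 - x)) = 0.
    by split=> x; have [h1 h2] := H x; lra.
  apply: (@convex_eq0 _ t) => //.
  - by have := pair f1 x G1; lra.
  - by have := pair f2 x G2; lra.
  by have := fS x; rewrite !ft; lra.
have D1 := gDFF_sym_superadditive G1 S1.
have D2 := gDFF_sym_superadditive G2 S2.
have tight (x y : R) : f x + f y = f (x + y) -> f1 x + f1 y = f1 (x + y).
  move=> e; have [] := @convex_eq0 _ t (f1 (x + y) - (f1 x + f1 y))
    (f2 (x + y) - (f2 x + f2 y)) t01'.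
  - by have := D1 x y; lra.
  - by have := D2 x y; lra.
  - by move: e; rewrite !ft; lra.
  by lra.
have flat (x y : R) : x <= y -> f y = f x -> f1 y = f1 x.
  move=> xy e; have [] := @convex_eq0 _ t (f1 y - f1 x) (f2 y - f2 x) t01'.
  - by have := gDFF_sym_mono G1 S1 _ _ xy; lra.
  - by have := gDFF_sym_mono G2 S2 _ _ xy; lra.
  - by move: e; rewrite !ft; lra.
  by lra.
have f10 := gDFF_sym_at0 G1 S1.
pose M1 := - f1 (- c) / c.
have lin1 (h : R) : 0 <= h <= c -> f1 (- h) = - (M1 * h).
  move=> hc; have e : c * - f1 (- h) = - f1 (- c) * h.
    apply: (additive_ge0_linear (fun h => - f1 (- h)) c c0 _ _ h hc) => [a b a0 b0 ab|a ac] /=.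
      have e : f (- a) + f (- b) = f (- a + - b) by rewrite !flin; [ring|lra..].
      by have := tight _ _ e; rewrite -opprD => <-; ring.
    by rewrite oppr_ge0 -f10 (gDFF_sym_mono G1 S1)//; lra.
  apply: (mulfI (lt0r_neq0 c0)).
  have -> : c * - (M1 * h) = f1 (- c) * h by rewrite /M1; field; rewrite gt_eqF.
  by lra.
have steep (z v : R) : z <= v -> v - z <= c -> f v - f z = M * (v - z) ->
    f1 v - f1 z = M1 * (v - z).
  move=> zv vc e; have := tight v (- (v - z)).
  have -> : v + - (v - z) = z by ring.
  rewrite lin1  ?(flin (- (v - z))); [|lra|lra] => h; have := h ltac:(lra); lra.
have half (g : R -> R) : unit_symmetric g -> g (1 / 2) = 1 / 2.
  move=> gS; have := gS (1 / 2).
  have -> : 1 - 1 / 2 = 1 / 2 :> R by field.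
  by lra.
have claim (n : nat) (x : R) : 1 / 2 - n%:R * c <= x <= 1 / 2 ->
    M * f1 x - M1 * f x = (M - M1) / 2.
  elim: n x => [|n IH] x xn.
    have -> : x = 1 / 2 by lra.
    by rewrite (half _ S1) (half _ fS); field.
  have [xn'|xn'] := leP (1 / 2 - n%:R * c) x; first by apply: IH; lra.
  have nc : 0 <= n%:R * c by rewrite mulr_ge0// ltW.
  have [z [xz zv zx vz]] := fcell n x ltac:(lra).
  have := IH (1 / 2 - n%:R * c) ltac:(lra).
  rewrite -[n.+1%:R]natr1 in xn.
  have h1 := flat _ _ xz zx.
  have vzc : 1 / 2 - n%:R * c - z <= c by lra.
  have h2 := steep _ _ zv vzc vz.
  rewrite -h1 -zx.
  set v := 1 / 2 - _ in h2 vz *.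
  have -> : f1 z = f1 v - M1 * (v - z) by lra.
  have -> : f z = f v - M * (v - z) by lra.
  by move=> <-; ring.
have claim' (x : R) : x <= 1 / 2 -> M * f1 x - M1 * f x = (M - M1) / 2.
  move=> xh; have := truncnS_gt ((1 / 2 - x) / c); rewrite ltr_pdivrMr// => hn.
  by apply: (claim (Num.truncn ((1 / 2 - x) / c)).+1); lra.
have MM1 : M = M1.
  by have := claim' 0 ltac:(lra); rewrite f10 (gDFF_sym_at0 fG fS); lra.
have eqlow (x : R) : x <= 1 / 2 -> f1 x = f x.
  move=> /claim'; rewrite -MM1 => e; apply: (mulfI (lt0r_neq0 M0)); lra.
apply: n1; apply/funext => x; have [xh|xh] := leP x (1 / 2); first exact: eqlow.
by have := S1 x; have := fS x; rewrite (eqlow (1 - x)); lra.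
Qed.

(** * The two-slope function through a superadditive sequence *)

(** The supremum over all integers n of G n + K min (y - n) 0, with K = - G (- 1)
the largest increment of G.  Only the two integers around y compete for it
([fill_ge], [fill_attained]), so that a maximum of two terms suffices. *)
Definition two_slope_fill {R : realType} (G : int -> R) (y : R) : R :=
  let k := Num.floor y in
  Num.max (G k) (G (k + 1) + - G (- 1) * (y - (k + 1)%:~R)).

Section TwoSlopeFill.
Context {R : realType} {G : int -> R}.
Hypotheses (GD : forall i j : int, G i + G j <= G (i + j)) (G0 : G 0 = 0)
  (G_mono : forall i j : int, i <= j -> G i <= G j).

Let K := - G (- 1).
Let F := two_slope_fill G.

Lemma fill_slope_ge0 : 0 <= K.
Proof. by rewrite /K oppr_ge0 -G0 G_mono. Qed.

Lemma fill_step_le (i j : int) : i <= j -> G j - G i <= K * (j - i)%:~R.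
Proof.
move=> ij; have -> : j = i + `|j - i|%N by lia.
elim: `|j - i|%N => [|n IH].
  by rewrite addr0 !subrr mulr0.
have := GD (i + n.+1) (- 1).
have -> : i + n.+1 - 1 = i + n by lia.
have -> : i + n.+1 - i = (i + n - i) + 1 by lia.
by rewrite intrD mulrDr -/K; rewrite /K in IH *; lra.
Qed.

Lemma fill_ge n y : G n + K * Num.min (y - n%:~R) 0 <= F y.
Proof.
have K0 := fill_slope_ge0.
have /andP[ky yk] := floor_itv y.
rewrite /F /two_slope_fill -/K; set k := Num.floor y in ky yk *.
rewrite le_max; have [nk|kn] := leP n k.
  apply/orP; left; rewrite (le_trans _ (G_mono _ _ nk))// gerDl.
  by rewrite mulr_ge0_le0// ge_min lexx orbT.
have kn' : k + 1 <= n by lia.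
apply/orP; right.
have h := fill_step_le _ _ kn'.
have : Num.min (y - n%:~R) 0 <= y - n%:~R by rewrite ge_min lexx.
move=> /(ler_wpM2l K0); rewrite intrB in h; lra.
Qed.

Lemma fill_attained y : exists n, F y = G n + K * Num.min (y - n%:~R) 0.
Proof.
have /andP[ky yk] := floor_itv y.
rewrite /F /two_slope_fill -/K; set k := Num.floor y in ky yk *.
have [h|h] := leP (G k) (G (k + 1) + K * (y - (k + 1)%:~R)).
  by exists (k + 1); rewrite min_l//; lra.
by exists k; rewrite min_r ?mulr0 ?addr0//; lra.
Qed.

(** The map t |-> K min t 0 is superadditive, and so is G: add the two optimal
integers. *)
Lemma fill_superadditive : superadditive F.
Proof.
move=> x y; have [n ->] := fill_attained x; have [m ->] := fill_attained y.
apply: le_trans (fill_ge (n + m) (x + y)).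
have : Num.min (x - n%:~R) 0 + Num.min (y - m%:~R) 0
       <= Num.min (x + y - (n + m)%:~R) 0.
  by rewrite intrD le_min !minEle; do 2 case: ifP; lra.
by move=> /(ler_wpM2l fill_slope_ge0); have := GD n m; lra.
Qed.

Lemma fill_mono : {homo F : x y / x <= y}.
Proof.
move=> x y xy; have [n ->] := fill_attained x; apply: le_trans (fill_ge n y).
rewrite lerD2l ler_wpM2l ?fill_slope_ge0// !minEle; do 2 case: ifP; lra.
Qed.

Lemma fill_bounds y : G (Num.floor y) <= F y <= G (Num.floor y + 1).
Proof.
have /andP[_ yk] := floor_itv y.
rewrite /F /two_slope_fill le_max lexx/= ge_max G_mono ?lerDl//= gerDl.
by rewrite mulr_ge0_le0 ?fill_slope_ge0//; lra.
Qed.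

Lemma fill_int n : F n%:~R = G n.
Proof.
rewrite /F /two_slope_fill intrKfloor; apply/max_idPl.
by have := GD (n + 1) (- 1); rewrite addrK intrD; lra.
Qed.

Lemma fill_near0 (y : R) : - 1 <= y <= 0 -> F y = K * y.
Proof.
move=> /andP[y1 y0]; have K0 := fill_slope_ge0; apply/le_anti/andP; split; last first.
  by have := fill_ge 0 y; rewrite G0 min_l ?subr0 ?add0r.
have [n ->] := fill_attained y; have [n0|n0] := leP 0 n.
  have := fill_step_le _ _ n0; rewrite G0 !subr0.
  have : Num.min (y - n%:~R) 0 <= y - n%:~R by rewrite ge_min lexx.
  by move=> /(ler_wpM2l K0); lra.
have : G n <= - K by rewrite /K opprK G_mono//; lia.
have : Num.min (y - n%:~R) 0 <= 0 by rewrite ge_min lexx orbT.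
by move=> /(ler_wpM2l K0); nra.
Qed.

(** The break z is where the line of slope K through (k + 1, G (k + 1)) reaches
the level G k; for y beyond the break, z = y. *)
Lemma fill_cell (k : int) (y : R) : 0 < K -> k%:~R <= y < (k + 1)%:~R ->
  exists z : R, [/\ y <= z, z <= (k + 1)%:~R, F z = F y &
    F (k + 1)%:~R - F z = K * ((k + 1)%:~R - z)].
Proof.
move=> K0 yk; rewrite fill_int.
have Fcell x : k%:~R <= x < (k + 1)%:~R ->
    F x = Num.max (G k) (G (k + 1) + K * (x - (k + 1)%:~R)).
  by move=> xk; rewrite /F /two_slope_fill (floor_def xk).
have [h|h] := leP (G k) (G (k + 1) + K * (y - (k + 1)%:~R)).
  exists y; split=> //; first by lra.
  by rewrite Fcell// max_r//; ring.
pose z := (k + 1)%:~R - (G (k + 1) - G k) / K.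
have Kz : K * ((k + 1)%:~R - z) = G (k + 1) - G k.
  by rewrite /z; field; rewrite gt_eqF.
have Gk : G k <= G (k + 1) by rewrite G_mono// lerDl.
have yz : y <= z by rewrite -(ler_pM2l K0); lra.
have zk : z <= (k + 1)%:~R by rewrite -(ler_pM2l K0); lra.
suff Fz : F z = G k.
  by exists z; split=> //; [rewrite Fz Fcell// max_l// ltW|rewrite Fz Kz].
move: zk; rewrite le_eqVlt => /predU1P[zk|zk].
  by rewrite zk fill_int; move: Kz; rewrite zk subrr mulr0; lra.
by rewrite Fcell ?max_l//; lra.
Qed.

(** For w + z - 2m >= - 1 the right-hand side is bounded below by the lines of
slope K through (m, 1/2), whose sum is exactly 1 + F (w + z - 2m).  Otherwise
round to the grid: this moves the argument w + z - 2m by at most two steps, all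
on the negative side, at a cost sigma that the slack pays for. *)
Lemma fill_reflected (m : int) sigma : G m = 1 / 2 ->
  (forall i j : int, i <= m -> j <= m -> i + j < m + m ->
     1 + G (i + j - (m + m)) + sigma <= G i + G j) ->
  (forall k : int, k + 2 <= - 1 -> G (k + 2) <= G k + sigma) ->
  forall w z : R, w <= m%:~R -> z <= m%:~R ->
    1 + F (w + z - (m + m)%:~R) <= F w + F z.
Proof.
move=> Gm slack smooth w z wm zm; rewrite intrD.
have [near0|far] := leP (- 1) (w + z - (m%:~R + m%:~R)).
  rewrite fill_near0; last by apply/andP; split=> //; lra.
  have := fill_ge m w; have := fill_ge m z.
  by rewrite Gm !min_l; lra.
have /andP[Fw _] := fill_bounds w; have /andP[Fz _] := fill_bounds z.
have /andP[iw wi] := floor_itv w; have /andP[jz zj] := floor_itv z.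
set i := Num.floor w in Fw iw wi; set j := Num.floor z in Fz jz zj.
have im : i <= m by rewrite -(ler_int R); lra.
have jm : j <= m by rewrite -(ler_int R); lra.
have ijm : i + j < m + m by rewrite -(ltr_int R) !intrD; lra.
have := slack i j im jm ijm; set k := i + j - (m + m) => Hk.
set c := w + z - _ in far *.
have /andP[_ Fc] := fill_bounds c.
have /andP[lc cl] := floor_itv c.
set l := Num.floor c in Fc lc cl.
have l2 : l + 1 <= - 1 by rewrite lezD1 -(ltr_int R); lra.
have lk : l + 1 <= k + 2.
  rewrite lezD1 -(ltr_int R) /k !intrD !intrN !intrD; rewrite intrD in wi zj.
  by rewrite /c in lc; lra.
suff : G (l + 1) <= G k + sigma by lra.
have [k2|k2] := leP (k + 2) (- 1).
  exact: le_trans (G_mono _ _ lk) (smooth _ k2).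
have k3 : - 3 <= k by move: k2; clear; lia.
apply: le_trans (G_mono _ _ l2) _.
apply: (@le_trans _ _ (G (- 3) + sigma)); first exact: (smooth (- 3)).
by rewrite lerD2r G_mono.
Qed.

End TwoSlopeFill.

(** * Reflection at 1/2 *)

Definition symmetrize {R : realType} (F : R -> R) (x : R) : R :=
  if x <= 1 / 2 then F x else 1 - F (1 - x).

Section Symmetrize.
Context {R : realType} {F : R -> R}.
Hypotheses (FD : superadditive F) (Fh : F (1 / 2) = 1 / 2) (F1 : F 1 <= 1).

Lemma symmetrize_le (x : R) : x <= 1 / 2 -> symmetrize F x = F x.
Proof. by rewrite /symmetrize => ->. Qed.

Lemma symmetrize_ge (x : R) : 1 / 2 <= x -> symmetrize F x = 1 - F (1 - x).
Proof.
rewrite le_eqVlt /symmetrize => /predU1P[<-|]; last by rewrite ltNge => /negPf ->.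
have -> : 1 - 1 / 2 = 1 / 2 :> R by field.
by rewrite lexx Fh; field.
Qed.

Lemma symmetrize_symmetric : unit_symmetric (symmetrize F).
Proof.
move=> x; have [x2|x2] := leP x (1 / 2).
  rewrite symmetrize_le// symmetrize_ge; last lra.
  have -> : 1 - (1 - x) = x by ring.
  by ring.
rewrite symmetrize_ge; last lra.
rewrite symmetrize_le; last lra.
by ring.
Qed.

Hypothesis Fr : forall w z : R, w <= 1 / 2 -> z <= 1 / 2 -> 1 + F (w + z - 1) <= F w + F z.

(** By symmetry f x + f y <= f (x + y) says that three values of f at points of
sum 1 add up to at most 1.  When at most one of them lies beyond 1/2, this is
superadditivity of F; two points beyond 1/2 make the hypothesis [Fr]. *)
Lemma symmetrize_superadditive : superadditive (symmetrize F).
Proof.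
suff H x y : x <= y -> symmetrize F x + symmetrize F y <= symmetrize F (x + y).
  move=> x y; have [|/ltW yx] := leP x y; first exact: H.
  by rewrite addrC [x + y]addrC H.
move=> xy.
have [y2|/ltW y2] := leP y (1 / 2).
  rewrite (symmetrize_le x) ?(symmetrize_le y)//; last lra.
  have [s2|/ltW s2] := leP (x + y) (1 / 2); first by rewrite symmetrize_le ?FD.
  rewrite symmetrize_ge//.
  have h : F (x + y) + F (1 - (x + y)) <= 1.
    by apply: le_trans F1; apply: le_trans (FD _ _) _; rewrite addrC subrK.
  by have := FD x y; lra.
rewrite [symmetrize F y]symmetrize_ge//.
have [x2|/ltW x2] := leP x (1 / 2).
  rewrite (symmetrize_le x)//.
  have [s2|/ltW s2] := leP (x + y) (1 / 2).
    rewrite symmetrize_le//.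
    have := Fr (x + y) (1 - y) s2 ltac:(lra).
    have -> : x + y + (1 - y) - 1 = x by ring.
    by lra.
  rewrite symmetrize_ge//; have := FD x (1 - (x + y)).
  have -> : x + (1 - (x + y)) = 1 - y by ring.
  by lra.
rewrite !symmetrize_ge//; last lra.
have := Fr (1 - x) (1 - y) ltac:(lra) ltac:(lra).
have -> : 1 - x + (1 - y) - 1 = 1 - (x + y) by ring.
by lra.
Qed.

End Symmetrize.

(** * A perturbation with slack *)

(** A subadditive function k with k x = x on [0, 1], so that T x - (T - 1) k x
agrees there with x.  To the left of 1/2 two values of k add up to at most 1,
whereas 1 + k is 3/2 on the negative axis: this difference is the slack. *)
Definition defect {R : realType} (x : R) : R :=
  if x < 0 then 1 / 2 else if x <= 1 then x else 1.

Section Defect.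
Context {R : realType}.
Implicit Types x y w z : R.

Lemma defect_subadditive x y : defect (x + y) <= defect x + defect y.
Proof. by rewrite /defect; do !case: ifPn; rewrite -?ltNge -?leNgt; lra. Qed.

Lemma defect_increment x y : x <= y -> defect y - defect x <= y - x.
Proof. by rewrite /defect; do !case: ifPn; rewrite -?ltNge -?leNgt; lra. Qed.

Lemma defect_itv x : 0 <= defect x <= 1.
Proof. by rewrite /defect; do !case: ifPn; rewrite -?ltNge -?leNgt; lra. Qed.

Lemma defect_lt0 x : x < 0 -> defect x = 1 / 2.
Proof. by rewrite /defect => ->. Qed.

Lemma defect_id x : 0 <= x <= 1 -> defect x = x.
Proof. by move=> /andP[x0 x1]; rewrite /defect ltNge x0 x1. Qed.

Lemma defect_slack w z : w <= 1 / 2 -> z <= 1 / 2 -> w + z < 1 ->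
  defect w + defect z + 1 / 2 <= 1 + defect (w + z - 1).
Proof.
by move=> w2 z2 wz; rewrite /defect; do !case: ifPn; rewrite -?ltNge -?leNgt; lra.
Qed.

End Defect.

(** A convex combination of superadditive functions.  The weight d trades distance
to phi against slack; T is meant to be the slope of the line above phi, so that
the function mixed in stays at bounded distance from phi. *)
Definition perturb {R : realType} (phi : R -> R) (T d x : R) : R :=
  (1 - d) * phi x + d * (T * x - (T - 1) * defect x).

Section Perturbation.
Context {R : realType} {phi : R -> R}.
Hypotheses (phiG : gDFF phi) (phiS : unit_symmetric phi).
Variables T d : R.
Hypotheses (phiT : forall x : R, phi x <= T * x) (T1 : 1 < T) (d01 : 0 < d < 1).

Local Notation p := (perturb phi T d).

Let phiD := gDFF_sym_superadditive phiG phiS.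
Let phi_mono := gDFF_sym_mono phiG phiS.
Let phi0 := gDFF_sym_at0 phiG phiS.
Let d0 : 0 <= d. Proof. by case/andP: d01 => /ltW. Qed.
Let d1 : 0 <= 1 - d. Proof. by case/andP: d01 => _ /ltW; rewrite subr_ge0. Qed.
Let dT : 0 < d * (T - 1). Proof. by rewrite mulr_gt0 ?subr_gt0//; case/andP: d01. Qed.

Lemma perturb_superadditive : superadditive p.
Proof.
move=> x y; rewrite /perturb.
have := ler_wpM2l d1 (phiD x y).
have := ler_wpM2l (ltW dT) (defect_subadditive x y).
lra.
Qed.

Lemma perturb_mono : {homo p : x y / x <= y}.
Proof.
move: (T1) (d0) (dT) => T1' d0' dT'; move=> x y xy; rewrite /perturb.
have := ler_wpM2l d1 (phi_mono _ _ xy).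
have := ler_wpM2l (ltW dT) (defect_increment x y xy).
have : 0 <= d * (y - x) by rewrite mulr_ge0//; lra.
lra.
Qed.

Lemma perturb_at0 : p 0 = 0.
Proof. by rewrite /perturb phi0 defect_id ?lexx ?ler01//; ring. Qed.

Lemma perturb_at_half : p (1 / 2) = 1 / 2.
Proof.
rewrite /perturb defect_id; last lra.
have := phiS (1 / 2).
have -> : 1 - 1 / 2 = 1 / 2 :> R by field.
move=> h; have -> : phi (1 / 2) = 1 / 2 by lra.
by field.
Qed.

Lemma perturb_at1 : p 1 = 1.
Proof.
rewrite /perturb defect_id; last lra.
by have := phiS 0; rewrite phi0 subr0 add0r => ->; ring.
Qed.

Lemma perturb_lt0 (x : R) : x < 0 -> p x < 0.
Proof.
move: (T1) (d0) (dT) => T1' d0' dT'; move=> x0; rewrite /perturb defect_lt0//.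
have : phi x <= 0 by rewrite -phi0 phi_mono// ltW.
move=> /(ler_wpM2l d1); rewrite mulr0.
have : d * (T * x) <= 0 by rewrite mulr_ge0_le0// mulr_ge0_le0 ?ltW//; lra.
lra.
Qed.

(** For phi the inequality without slack is superadditivity at 1 - w, 1 - z. *)
Lemma perturb_slack (w z : R) : w <= 1 / 2 -> z <= 1 / 2 -> w + z < 1 ->
  1 + p (w + z - 1) + d * (T - 1) / 2 <= p w + p z.
Proof.
move=> w2 z2 wz; have h : 1 + phi (w + z - 1) <= phi w + phi z.
  have := phiD (1 - w) (1 - z).
  have := phiS w; have := phiS z; have := phiS (w + z - 1).
  have -> : 1 - (w + z - 1) = 1 - w + (1 - z) by ring.
  lra.
have := ler_wpM2l d1 h.
have := ler_wpM2l (ltW dT) (defect_slack _ _ w2 z2 wz).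
rewrite /perturb; lra.
Qed.

Lemma perturb_modulus (x h : R) : 0 <= h -> x + h < 0 ->
  p (x + h) - p x <= T * h - phi (- h).
Proof.
move: (T1) (d0) (dT) => T1' d0' dT'; move=> h0 xh; rewrite /perturb !defect_lt0; [|lra..].
have := ler_wpM2l d1 (superadditive_increment phiD x h).
have : 0 <= T * h by rewrite mulr_ge0//; lra.
have : phi (- h) <= 0 by rewrite -phi0 phi_mono//; lra.
move: d01; nra.
Qed.

(** Both phi and the function mixed into it lie between T x - (T - 1) and T x. *)
Lemma perturb_close x : `|phi x - p x| <= d * (T - 1).
Proof.
move: (T1) (d0) (dT) => T1' d0' dT'; have /andP[k0 k1] := defect_itv x.
have := phiT x; have := phiT (1 - x); have := phiS x => s h1 h2.
have e1 : `|phi x - (T * x - (T - 1) * defect x)| <= T - 1.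
  by rewrite ler_norml; nra.
have -> : phi x - p x = d * (phi x - (T * x - (T - 1) * defect x)).
  by rewrite /perturb; ring.
by rewrite normrM (ger0_norm d0) ler_wpM2l.
Qed.

End Perturbation.

(** * Approximation *)

(** The grid has mesh h = 1 / (2m), so that 1/2 and 1 are grid points; the
oscillation of p is controlled over two cells, 2 h = 1 / m. *)
Lemma two_slope_approximation {R : realType} (p : R -> R) (m : nat) (sigma : R) :
  (0 < m)%N -> superadditive p -> {homo p : x y / x <= y} ->
  p 0 = 0 -> p (1 / 2) = 1 / 2 -> p 1 = 1 -> (forall x, x < 0 -> p x < 0) ->
  (forall w z, w <= 1 / 2 -> z <= 1 / 2 -> w + z < 1 ->
    1 + p (w + z - 1) + sigma <= p w + p z) ->
  (forall x, x + m%:R^-1 < 0 -> p (x + m%:R^-1) <= p x + sigma) ->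
  exists f, [/\ extreme_gDFF f, unit_symmetric f &
    forall x, x <= 1 / 2 -> p (x - (2 * m%:R)^-1) <= f x <= p (x + (2 * m%:R)^-1)].
Proof.
move=> m0 pD p_mono p0 ph p1 p_lt0 slack modulus.
have m0' : 0 < m%:R :> R by rewrite ltr0n.
set h := (2 * m%:R)^-1.
have h0 : 0 < h by rewrite invr_gt0 mulr_gt0.
have mh : m%:~R * h = 1 / 2 by rewrite /h -pmulrn; field; rewrite gt_eqF.
have h2 : m%:R^-1 = h + h by rewrite /h; field; rewrite gt_eqF.
clearbody h; pose G (i : int) := p (i%:~R * h).
have GD i j : G i + G j <= G (i + j) by rewrite /G intrD mulrDl.
have G0 : G 0 = 0 by rewrite /G mul0r.
have G_mono (i j : int) : i <= j -> G i <= G j.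
  by move=> ij; apply: p_mono; rewrite ler_pM2r// ler_int.
have Gm : G m = 1 / 2 by rewrite /G mh.
have G_slack (i j : int) : i <= m -> j <= m -> i + j < m + m ->
    1 + G (i + j - (m%:Z + m)) + sigma <= G i + G j.
  move=> im jm ijm; rewrite /G.
  have -> : (i + j - (m%:Z + m))%:~R * h = i%:~R * h + j%:~R * h - 1.
    by rewrite intrB !intrD !mulrBl !mulrDl mh; lra.
  have lh (k l : int) : k <= l -> k%:~R * h <= l%:~R * h.
    by move=> kl; rewrite ler_pM2r// ler_int.
  apply: slack.
  - by rewrite -mh lh.
  - by rewrite -mh lh.
  - have : (i + j)%:~R * h < (m%:Z + m)%:~R * h by rewrite ltr_pM2r// ltr_int.
    by rewrite !intrD !mulrDl mh; lra.
have G_mod k : k + 2 <= - 1 -> G (k + 2) <= G k + sigma.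
  move=> k2; rewrite /G.
  have e : (k + 2)%:~R * h = k%:~R * h + m%:R^-1 by rewrite intrD mulrDl h2; ring.
  rewrite e; apply: modulus; rewrite -e nmulr_rlt0// -[0]/(0%:~R) ltr_int.
  by rewrite (le_lt_trans k2).
have K0 : 0 < - G (- 1).
  by rewrite oppr_gt0 /G p_lt0// mulN1r oppr_lt0.
pose F x := two_slope_fill G (x / h).
have hK x : x * h / h = x by rewrite mulfK// gt_eqF.
have mhV : 1 / 2 / h = m%:~R by rewrite -mh hK.
have FD : superadditive F.
  by move=> x y; rewrite /F mulrDl; exact: fill_superadditive.
have F_mono : {homo F : x y / x <= y}.
  by move=> x y xy; apply: fill_mono => //; rewrite ler_pM2r// invr_gt0.
have Fh : F (1 / 2) = 1 / 2 by rewrite /F mhV fill_int.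
have F0 : F 0 = 0 by rewrite /F mul0r (fill_int GD 0).
have F1 : F 1 = 1.
  have -> : 1 = (m%:Z + m)%:~R * h by rewrite intrD mulrDl mh; field.
  rewrite /F hK fill_int// /G intrD mulrDl mh.
  have -> : 1 / 2 + 1 / 2 = 1 :> R by field.
  by rewrite p1.
have Fr w z : w <= 1 / 2 -> z <= 1 / 2 -> 1 + F (w + z - 1) <= F w + F z.
  move=> w2 z2; rewrite /F.
  have -> : (w + z - 1) / h = w / h + z / h - (m%:Z + m)%:~R.
    by rewrite intrD -mhV; field; rewrite gt_eqF.
  by apply: (fill_reflected GD G0 G_mono m sigma) => //;
    rewrite -mhV ler_pM2r// invr_gt0.
pose f := symmetrize F.
have fD : superadditive f by apply: symmetrize_superadditive => //; rewrite F1.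
have fS : unit_symmetric f by exact: symmetrize_symmetric.
have fle x : x <= 1 / 2 -> f x = F x by exact: symmetrize_le.
have fG : gDFF f.
  apply: superadditive_gDFF => //; first by rewrite fle//; lra.
  move=> x x1; have [x2|/ltW x2] := leP x (1 / 2).
    by rewrite fle//; have := F_mono _ _ x2; rewrite Fh; lra.
  rewrite /f symmetrize_ge//.
  have := F_mono _ _ (_ : 0 <= 1 - x); rewrite F0 subr_ge0 => /(_ x1).
  by rewrite gerDl oppr_le0.
exists f; split=> //; last first.
  move=> x x2; rewrite fle//.
  have /andP[lo up] := fill_bounds G0 G_mono (x / h).
  have /andP[l1 l2] := floor_itv (x / h).
  rewrite /F; apply/andP; split.
    apply: le_trans lo; apply: p_mono.
    move: l2; rewrite intrD ltr_pdivrMr// mulrDl; lra.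
  apply: le_trans up _; apply: p_mono.
  move: l1; rewrite ler_pdivlMr// intrD mulrDl; lra.
apply: (two_slope_extreme f (- G (- 1) / h) h) => //; first exact: divr_gt0.
  move=> x /andP[xh x0]; rewrite fle; last lra.
  rewrite /F fill_near0//; first by rewrite mulrAC mulrA.
  by rewrite ler_pdivlMr// ler_pdivrMr// mulN1r mul0r xh.
move=> n x /andP[xl xu].
pose k : int := m%:Z - n.+1%:Z.
have kh : (k + 1)%:~R * h = 1 / 2 - n%:R * h.
  rewrite /k intrD intrB mulrDl mulrBl mh -!pmulrn -[n.+1%:R]natr1; lra.
have xk : k%:~R <= x / h < (k + 1)%:~R.
  rewrite ler_pdivlMr// ltr_pdivrMr// kh xu andbT.
  by move: kh; rewrite intrD mulrDl; move: xl; rewrite -[n.+1%:R]natr1; lra.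
have [z [xz zk Fzx Fzk]] := fill_cell GD G_mono k _ K0 xk.
have nh : 0 <= n%:R * h by rewrite mulr_ge0// ltW.
have zh : z * h <= 1 / 2 - n%:R * h by rewrite -kh ler_pM2r.
exists (z * h); split=> //.
- by rewrite -ler_pdivrMr.
- by rewrite !fle; [rewrite /F hK|lra..].
- rewrite !fle; [|lra..]; rewrite -kh /F !hK Fzk.
  by field; rewrite gt_eqF.
Qed.

Lemma id_extreme {R : realType} : extreme_gDFF (@id R).
Proof.
apply: (two_slope_extreme id 1 1) => //.
- by move=> x; rewrite addrC subrK.
- by move=> x _; rewrite mul1r.
- by move=> n x /andP[_ xu]; exists x; split=> //; [exact: ltW|ring].
Qed.

Theorem theorem12 (R : realType) (phi : R -> R)
    (phi_cont : continuous phi) (phi_max : restricted_maximal phi)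
    (eps : R) (eps_gt0 : 0 < eps) :
  exists phi_ext : R -> R,
    extreme_gDFF phi_ext /\ (sup_norm (phi \- phi_ext)%R < eps%:E)%E.
Proof.
suff [f [fext fclose]] :
    exists f, extreme_gDFF f /\ forall x, `|phi x - f x| <= eps / 2.
  exists f; split=> //; apply: (@le_lt_trans _ _ (eps / 2)%:E).
    by apply: ge_ereal_sup => _ [x _ <-]; rewrite lee_fin; exact: fclose.
  by rewrite lte_fin; lra.
have phiG : gDFF phi := phi_max.1.
have phiS := restricted_maximal_symmetric phi_max.
have phiD := gDFF_sym_superadditive phiG phiS.
have phi_mono := gDFF_sym_mono phiG phiS.
have phi0 := gDFF_sym_at0 phiG phiS.
have [T phiT] := superadditive_linear_bound phiD phi0 phi_mono.
have phi1 : phi 1 = 1 by have := phiS 0; rewrite phi0 subr0 add0r.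
have := phiT 1; rewrite phi1 mulr1 le_eqVlt => /predU1P[T1|T1].
  exists id; split; first exact: id_extreme.
  move=> x; have -> : phi x = x.
    by have := phiT x; have := phiT (1 - x); have := phiS x; rewrite -T1; lra.
  by rewrite subrr normr0; lra.
(* d (T - 1) bounds the distance from phi to its perturbation; sigma is the
   resulting slack *)
pose d := Num.min (1 / 2) (eps / 4 / (T - 1)).
have T0 : 0 < T - 1 by lra.
have d01 : 0 < d < 1.
  by rewrite lt_min gt_min !divr_gt0//; apply/andP; split=> //; lra.
have deps : d * (T - 1) <= eps / 4 by rewrite -ler_pdivlMr// ge_min lexx orbT.
pose sigma := d * (T - 1) / 2.
have sigma0 : 0 < sigma by rewrite !divr_gt0// mulr_gt0//; case/andP: d01.
pose e := Num.min sigma (eps / 4).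
have e0 : 0 < e by rewrite lt_min sigma0 divr_gt0.
have [m [m0 me]] : exists m : nat, (0 < m)%N /\ T / m%:R - phi (- m%:R^-1) <= e.
  have /cvgrPdist_lt/(_ (e / 2)) := phi_cont 0.
  (* half of e for the oscillation of phi at 0, half for T / m *)
  move=> /(_ ltac:(lra)) /nbhs_ballP[r /= r0 near0].
  pose C := r^-1 + 2 * T / e.
  exists (Num.truncn C).+1; split=> //; have := truncnS_gt C.
  set m := (Num.truncn C).+1 => Cm.
  have m0 : 0 < m%:R :> R by rewrite ltr0n.
  have rV : 0 < r^-1 by rewrite invr_gt0.
  have Te : 0 < 2 * T / e by rewrite divr_gt0// mulr_gt0//; lra.
  have rm : m%:R^-1 < r.
    by rewrite -[r]invrK ltf_pV2// ?posrE//; rewrite /C in Cm; lra.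
  have Tm : T / m%:R <= e / 2.
    rewrite ler_pdivrMr//.
    have : 2 * T < m%:R * e by rewrite -ltr_pdivrMr//; rewrite /C in Cm; lra.
    lra.
  have := near0 (- m%:R^-1); rewrite /ball/= sub0r opprK gtr0_norm ?invr_gt0//.
  by move=> /(_ rm); rewrite phi0 sub0r ltr_norml; lra.
have e_sigma : e <= sigma by rewrite ge_min lexx.
have e_eps : e <= eps / 4 by rewrite ge_min lexx orbT.
have mV : 0 < m%:R^-1 :> R by rewrite invr_gt0 ltr0n.
have [f [fext fS fp]] : exists f, [/\ extreme_gDFF f, unit_symmetric f & forall x,
    x <= 1 / 2 -> perturb phi T d (x - (2 * m%:R)^-1) <= f x
               <= perturb phi T d (x + (2 * m%:R)^-1)].
  apply: (two_slope_approximation _ m sigma) => //.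
  - exact: perturb_superadditive.
  - exact: perturb_mono.
  - exact: perturb_at0.
  - exact: perturb_at_half.
  - exact: perturb_at1.
  - exact: perturb_lt0.
  - exact: perturb_slack.
  - move=> x xm.
    have := perturb_modulus phiG phiS T d T1 d01 x m%:R^-1 (ltW mV) xm; lra.
exists f; split=> //.
set h := (2 * m%:R)^-1 in fp.
have hm : m%:R^-1 = h + h by rewrite /h; field; rewrite pnatr_eq0 -lt0n.
(* - phi (- h) bounds every increment of phi over a step h *)
have h_eps : - phi (- h) <= eps / 4.
  have : phi (- m%:R^-1) <= phi (- h) by apply: phi_mono; lra.
  have : 0 < T / m%:R by rewrite mulr_gt0//; lra.
  lra.
have close x : x <= 1 / 2 -> `|phi x - f x| <= eps / 2.
  move=> /fp/andP[lo up].
  have := perturb_close phiS T d phiT T1 d01 (x - h).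
  have := perturb_close phiS T d phiT T1 d01 (x + h).
  have := superadditive_increment phiD x h.
  have := superadditive_increment phiD (x - h) h; rewrite subrK.
  rewrite !ler_norml; lra.
move=> x; have [/close//|x2] := leP x (1 / 2).
have := close (1 - x) ltac:(lra); rewrite distrC.
have -> : phi x = 1 - phi (1 - x) by have := phiS x; lra.
have -> : f x = 1 - f (1 - x) by have := fS x; lra.
by have -> : 1 - phi (1 - x) - (1 - f (1 - x)) = f (1 - x) - phi (1 - x) by ring.
Qed.
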